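(* Let $f:S\to S$ be a function on a finite set $S$, and let $r=|f(S)|$ be the rank of $f$. Starting with an $f$-compatible left eigenvector $v_r\in\mathcal V_r$ of $F^{(r)}$, the hierarchy of vectors $$v_r,\quad v_{r-1}=v_rE^{(r,r-1)},\ \ldots,\ v_\ell=v_{\ell+1}E^{(\ell+1,\ell)},\ \ldots,\ v_1=v_2E^{(2,1)}$$ are $f$-compatible left eigenvectors in their respective layers, i.e. $v_\ell$ is an $f$-compatible left eigenvector of $F^{(\ell)}$ for each $1\le\ell\le r$. They are all with the same eigenvalue.
   Context: $\mathcal P_\ell$ denotes the set of $\ell$-element subsets of $S$, and $\mathcal V_\ell$ the real vector space of row vectors $v=(v(I))_{I\in\mathcal P_\ell}$. A set $I\in\mathcal P_\ell$ is $f$-preserved if $f(I)\in\mathcal P_\ell$, i.e. $|f(I)|=|I|$. A vector $v\in\mathcal V_\ell$ is $f$-compatible if $v(I)\neq0$ implies that $I$ is $f$-preserved. The matrix $F^{(\ell)}$ is indexed by $\mathcal P_\ell\times\mathcal P_\ell$, with $F^{(\ell)}_{IJ}=1$ if $f(I)=J$ and $0$ otherwise. The matrix $E^{(\ell+1,\ell)}$ is indexed by $\mathcal P_{\ell+1}\times\mathcal P_\ell$, with $E^{(\ell+1,\ell)}_{IJ}=1$ if $J\subset I$ and $0$ otherwise.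
   Formalization: For eigenvalue 0 a vector v_ℓ of the hierarchy may be zero, so the claim as written fails; what is proved is f-compatibility and the eigenvalue equation with the same eigenvalue in every layer, and that v_ℓ is nonzero whenever the eigenvalue is nonzero. *)

(* Defs.v *)
From HB Require Import structures.
From mathcomp Require Import all_boot all_order all_algebra.
From mathcomp Require Import reals.

Set Implicit Arguments.
Unset Strict Implicit.
Unset Printing Implicit Defensive.

Import GRing.Theory.
Local Open Scope ring_scope.

Definition layer (S : finType) (l : nat) : {set {set S}} :=
  [set I : {set S} | #|I| == l].

(* Rows and columns are numbered by [enum_val], so that [enum_val i] is the
   i-th l-subset of S and the entry v(I) is [v 0 i] where [enum_val i = I]. *)
Definition layer_vec (R : realType) (S : finType) (l : nat) :=
  'rV[R]_#|layer S l|.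

Definition f_preserved (S : finType) (f : S -> S) (I : {set S}) : Prop :=
  #|f @: I| = #|I|.

Definition f_compatible (R : realType) (S : finType) (f : S -> S) (l : nat)
    (v : layer_vec R S l) : Prop :=
  forall i : 'I_#|layer S l|, v 0 i <> 0 -> f_preserved f (enum_val i).

Definition Fmx (R : realType) (S : finType) (f : S -> S) (l : nat) :
    'M[R]_#|layer S l| :=
  \matrix_(i < #|layer S l|, j < #|layer S l|)
    (f @: (enum_val i : {set S}) == enum_val j)%:R.

Definition Emx (R : realType) (S : finType) (l : nat) :
    'M[R]_(#|layer S l.+1|, #|layer S l|) :=
  \matrix_(i < #|layer S l.+1|, j < #|layer S l|)
    ((enum_val j : {set S}) \subset (enum_val i : {set S}))%:R.

Definition rank_fun (S : finType) (f : S -> S) : nat := #|f @: [set: S]|.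

Definition left_eigenvector (R : realType) (n : nat) (A : 'M[R]_n) (a : R)
    (v : 'rV[R]_n) : Prop :=
  v <> 0 /\ v *m A = a *: v.

(* Main.v *)
Require Import Defs.
From HB Require Import structures.
From mathcomp Require Import all_boot all_order all_algebra.
From mathcomp Require Import reals.

Set Implicit Arguments.
Unset Strict Implicit.
Unset Printing Implicit Defensive.

Import GRing.Theory.
Local Open Scope ring_scope.

(** On [f]-compatible vectors the matrices [F] and [E] intertwine: if [f] is
    injective on [I], then [f] maps the [l]-subsets of [I] bijectively onto the
    [l]-subsets of [f @: I], so removing a point and applying [f] commute
    ([Emx_Fmx_preserved], [Emx_Fmx_compatible]).  Injectivity on [I] restricts
    to subsets of [I], so compatibility also descends
    ([f_compatible_mul_Emx]).  Hence the eigen-equation goes down the hierarchy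
    with the same eigenvalue.

    What remains is that no vector of the hierarchy vanishes when [a <> 0].
    The sum of the entries detects this.  Every [l.+1]-set has [l.+1] subsets
    of size [l], so each step multiplies the sum by [l.+1]
    ([entry_sum_mul_Emx]).  In the top layer every preserved set is mapped to
    the whole image of [f], so [v *m F] is the sum of the entries of [v] times
    the indicator of that image, and a zero sum would force [a *: v = 0]
    ([entry_sum_top_neq0]). *)

Lemma card_enum_layer (S : finType) (l : nat) (i : 'I_#|layer S l|) :
  #|(enum_val i : {set S})| = l.
Proof. by have := enum_valP i; rewrite inE => /eqP. Qed.

Lemma f_preserved_subset (S : finType) (f : S -> S) (I J : {set S}) :
  J \subset I -> f_preserved f I -> f_preserved f J.
Proof.
move=> sJI /eqP/imset_injP finj; apply/eqP/imset_injP.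
by apply: sub_in2 finj; apply/subsetP.
Qed.

(** Since [f] is injective on [I], the only possible preimage of [K] inside
    [I] is [I :&: f @^-1: K], and it is one exactly when [K \subset f @: I]. *)
Lemma sum_subsets_imset (R : realType) (S : finType) (f : S -> S) (l : nat)
    (I K : {set S}) :
  f_preserved f I -> #|K| = l ->
  \sum_(J in layer S l) (J \subset I)%:R * (f @: J == K)%:R
    = (K \subset f @: I)%:R :> R.
Proof.
move=> /eqP/imset_injP finj cardK.
case: (boolP (K \subset f @: I)) => [sKI | nsKI]; last first.
  apply: big1 => J _; case: (boolP (J \subset I)) => [sJI | _]; last first.
    by rewrite mul0r.
  case: eqP => [eK | _]; last by rewrite mulr0.
  by move: nsKI; rewrite -eK imsetS.
pose J0 := I :&: f @^-1: K.
have fJ0 : f @: J0 = K.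
  apply/setP=> y; apply/imsetP/idP => [[x]|yK].
    by rewrite !inE => /andP[_ fxK] ->.
  have /imsetP[x xI ex] := subsetP sKI y yK.
  by exists x; rewrite // !inE xI -ex.
have sJ0 : J0 \subset I by apply: subsetIl.
have cardJ0 : J0 \in layer S l.
  rewrite inE -cardK -fJ0 card_in_imset //.
  by apply: sub_in2 finj; apply/subsetP.
rewrite (bigD1 J0) //= sJ0 fJ0 eqxx mulr1 big1 ?addr0 // => J /andP[_ neJ].
case: (boolP (J \subset I)) => [sJI | _]; last by rewrite mul0r.
case: eqP => [eK | _]; last by rewrite mulr0.
case/eqP: neJ; apply/setP=> x; rewrite !inE.
apply/idP/andP => [xJ | [xI fxK]].
  by rewrite (subsetP sJI) // -eK imset_f.
move: fxK; rewrite -eK => /imsetP[y yJ efxy].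
by rewrite (finj x y xI (subsetP sJI y yJ) efxy).
Qed.

Lemma Emx_Fmx_preserved (R : realType) (S : finType) (f : S -> S) (l : nat)
    (i : 'I_#|layer S l.+1|) :
  f_preserved f (enum_val i) ->
  row i (Emx R S l *m Fmx R f l) = row i (Fmx R f l.+1 *m Emx R S l).
Proof.
move=> fI; apply/rowP=> k; rewrite !mxE.
under eq_bigr do rewrite !mxE.
under [RHS]eq_bigr do rewrite !mxE.
rewrite -(big_enum_val (A := mem (layer S l)) (fun J : {set S} =>
  (J \subset enum_val i)%:R * (f @: J == enum_val k)%:R)).
rewrite -(big_enum_val (A := mem (layer S l.+1)) (fun J : {set S} =>
  (f @: (enum_val i : {set S}) == J)%:R * (enum_val k \subset J)%:R)).
rewrite sum_subsets_imset ?card_enum_layer //.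
have fIl : f @: (enum_val i : {set S}) \in layer S l.+1.
  by rewrite inE fI card_enum_layer.
rewrite (bigD1 _ fIl) /= eqxx mul1r big1 ?addr0 // => J /andP[_ neJ].
by rewrite eq_sym (negbTE neJ) mul0r.
Qed.

Lemma Emx_Fmx_compatible (R : realType) (S : finType) (f : S -> S) (l : nat)
    (v : layer_vec R S l.+1) :
  f_compatible f v ->
  v *m Emx R S l *m Fmx R f l = v *m Fmx R f l.+1 *m Emx R S l.
Proof.
move=> fv; rewrite -!mulmxA [LHS]mulmx_sum_row [RHS]mulmx_sum_row.
apply: eq_bigr => i _; case: (eqVneq (v 0 i) 0) => [-> | /eqP vi].
  by rewrite !scale0r.
by rewrite Emx_Fmx_preserved //; apply: fv.
Qed.

Lemma f_compatible_mul_Emx (R : realType) (S : finType) (f : S -> S) (l : nat)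
    (v : layer_vec R S l.+1) :
  f_compatible f v -> f_compatible f (v *m Emx R S l : layer_vec R S l).
Proof.
move=> fv j; rewrite mxE => /eqP vEj.
(* A nonzero entry at J needs a nonzero entry of v at some I containing J. *)
have [i] : exists i, v 0 i * Emx R S l i j != 0.
  apply/existsP; apply: contraNT vEj; rewrite negb_exists => /forallP z.
  by rewrite big1 // => i _; apply/eqP; rewrite -[_ == _]negbK.
rewrite mxE mulf_eq0 negb_or => /andP[/eqP vi].
case: (boolP (_ \subset _)) => [sJI _ | _]; last by rewrite eqxx.
exact: f_preserved_subset sJI (fv i vi).
Qed.

Definition entry_sum (R : realType) (S : finType) (l : nat)
    (v : layer_vec R S l) : R := \sum_i v 0 i.

Lemma entry_sum_mul_Emx (R : realType) (S : finType) (l : nat)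
    (v : layer_vec R S l.+1) :
  entry_sum (v *m Emx R S l : layer_vec R S l) = entry_sum v * l.+1%:R.
Proof.
rewrite /entry_sum mulr_suml; under eq_bigr do rewrite mxE.
rewrite exchange_big /=; apply: eq_bigr => i _; rewrite -mulr_sumr.
congr (_ * _); under eq_bigr do rewrite mxE.
rewrite -(big_enum_val (A := mem (layer S l)) (fun J : {set S} =>
  (J \subset enum_val i)%:R)).
rewrite -natr_sum -big_mkcondr /= sum1_card; congr (_%:R).
have := cards_draws (enum_val i : {set S}) l.
rewrite card_enum_layer binSn => cardE; rewrite -[RHS]cardE.
apply: eq_card => J.
by rewrite [in RHS]inE unfold_in inE andbC.
Qed.

(** A preserved set of size [rank_fun f] has the whole image of [f] as its
    image, so [v *m Fmx R f _] only depends on the sum of the entries of [v]. *)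
Lemma entry_sum_top_neq0 (R : realType) (S : finType) (f : S -> S) (a : R)
    (v : layer_vec R S (rank_fun f)) :
  f_compatible f v -> left_eigenvector (Fmx R f (rank_fun f)) a v ->
  a <> 0 -> entry_sum v <> 0.
Proof.
move=> fv [v0 vF] a0 sv0.
have vF0 : v *m Fmx R f (rank_fun f) = 0.
  apply/rowP=> j; rewrite [RHS]mxE mxE.
  transitivity (entry_sum v * (f @: [set: S] == enum_val j)%:R); last first.
    by rewrite sv0 mul0r.
  rewrite /entry_sum mulr_suml; apply: eq_bigr => i _; rewrite mxE.
  case: (eqVneq (v 0 i) 0) => [-> | /eqP vi]; first by rewrite !mul0r.
  suff -> : f @: (enum_val i : {set S}) = f @: [set: S] by [].
  apply/eqP; rewrite eqEcard imsetS ?subsetT //=.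
  by rewrite (fv i vi) card_enum_layer.
move: vF; rewrite vF0 => /esym/eqP; rewrite scaler_eq0 => /orP[] /eqP //.
Qed.

(* When a = 0 a member v l of the hierarchy may vanish even though the top
   vector does not: for f = (1,2 |-> 1; 3,4 |-> 3) the 0-eigenvector
   e_13 - e_14 - e_23 + e_24 has v_1 = 0.  So v l <> 0 is only claimed for
   a <> 0; the eigen-equation and compatibility are claimed always. *)
Theorem mainTheorem6 (R : realType) (S : finType) (f : S -> S) (a : R)
    (v : forall l : nat, layer_vec R S l)
    (v_top_compatible : f_compatible f (v (rank_fun f)))
    (v_top_eigen : left_eigenvector (Fmx R f (rank_fun f)) a (v (rank_fun f)))
    (v_step : forall l : nat, (1 <= l < rank_fun f)%N ->
       v l = v l.+1 *m Emx R S l) :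
  forall l : nat, (1 <= l <= rank_fun f)%N ->
    [/\ f_compatible f (v l),
        v l *m Fmx R f l = a *: v l
      & (a <> 0 -> left_eigenvector (Fmx R f l) a (v l))].
Proof.
have claim d : forall l, (1 <= l)%N -> (l + d = rank_fun f)%N ->
    [/\ f_compatible f (v l), v l *m Fmx R f l = a *: v l
      & a <> 0 -> entry_sum (v l) <> 0].
  elim: d => [|d IHd] l l_gt0.
    rewrite addn0 => ->; split=> //; first by case: v_top_eigen.
    exact: entry_sum_top_neq0.
  rewrite addnS -addSn => eld; have [//|fv vF sv] := IHd l.+1 _ eld.
  have lr : (1 <= l < rank_fun f)%N by rewrite l_gt0 -eld leq_addr.
  rewrite (v_step l lr); split; first exact: f_compatible_mul_Emx.
    by rewrite Emx_Fmx_compatible // vF scalemxAl.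
  move=> a0; rewrite entry_sum_mul_Emx => /eqP.
  by rewrite mulf_eq0 Num.Theory.pnatr_eq0 orbF => /eqP; apply: sv.
move=> l /andP[l_gt0 l_le].
have [fv vF sv] := claim _ l l_gt0 (subnKC l_le).
split=> // a0; split=> // vl0; apply: (sv a0).
by rewrite /entry_sum vl0 big1 // => i _; rewrite mxE.
Qed.
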